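(* Let $E$ be a real topological vector space, and let $\Omega$ be a topological space. (a) There is a bijective correspondence $T \mapsto T^t$ between representations $T : E \to C_p(\Omega)$ and continuous functions $T^t : \Omega \to E'_{w*}$, such that $T(x)(\omega) = T^t(\omega)(x)$ for all $x\in E$, $\omega\in\Omega$. Under the correspondence from (a), the following properties of a representation $T : E \to C_p(\Omega)$ depend only on the image of $T^t$ in $E'_{w*}$: (b) A representation $T : E \to C_p(\Omega)$ is injective if and only if $T^t[\Omega]$ separates points on $E$. (c) A representation $T : E \to C_p(\Omega)$ is continuous as a map $E \to C_k(\Omega)$ if and only if $T^t[K]$ is equicontinuous for every compact subset $K \subseteq \Omega$. This is automatically the case if $E$ is a barrelled locally convex space (in particular, if $E$ is a Fréchet space). Furthermore, if $E$ is a preordered topological vector space with positive cone $E_+$, then: (d) A representation $T : E \to C_p(\Omega)$ is positive if and only if $T^t[\Omega] \subseteq E'_+$. (e) A representation $T : E \to C_p(\Omega)$ is bipositive if and only if $E_+$ is weakly closed and $E'_+$ is the weak-$*$ closed convex cone generated by $T^t[\Omega]$ (that is, the weak-$*$ closure in $E'$ of the convex cone generated by $T^t[\Omega]$).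
   Context: All vector spaces are real and all topological vector spaces are Hausdorff; it is not assumed that the topological dual $E'$ separates points on $E$. $E'_{w*}$ denotes $E'$ with the weak-$*$ topology; ''weakly closed'' means closed for the topology $\sigma(E,E')$ (possibly non-Hausdorff). $C(\Omega)$ is the vector space of all continuous functions $\Omega\to\mathbb{R}$; $C_p(\Omega)$ and $C_k(\Omega)$ denote $C(\Omega)$ with the topology of pointwise convergence, respectively of compact convergence (uniform convergence on compact subsets of $\Omega$). A representation is a continuous linear map from $E$ to $C_p(\Omega)$ or $C_k(\Omega)$. These function spaces carry the cone of everywhere non-negative functions. A set $S\subseteq E'$ separates points on $E$ if for every $x\in E\setminus\{0\}$ there is $\varphi\in S$ with $\varphi(x)\neq 0$. A set $S \subseteq E'$ is equicontinuous if for every $\varepsilon>0$ there is a $0$-neighbourhood $U\subseteq E$ with $|\varphi(u)|<\varepsilon$ for all $u\in U$, $\varphi\in S$. A locally convex space $E$ is barrelled if every weak-$*$ bounded subset of $E'$ is equicontinuous. A convex cone is a non-empty subset $\mathcal{K}$ with $\mathcal{K}+\mathcal{K}\subseteq\mathcal{K}$ and $\lambda\mathcal{K}\subseteq\mathcal{K}$ for all $\lambda\ge 0$; it need not satisfy $\mathcal{K}\cap-\mathcal{K}=\{0\}$. The convex cone generated by $M$ is the set of all finite (possibly empty) sums $\sum\lambda_i x_i$ with $\lambda_i\ge0$, $x_i\in M$. A preordered topological vector space is a topological vector space $E$ with a convex cone $E_+$ as positive cone. $E'_+$ is the set of continuous linear functionals that are non-negative on $E_+$. A linear map $T:E\to F$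 is positive if $T[E_+]\subseteq F_+$, and bipositive if $E_+=T^{-1}[F_+]$. *)

(* Defs.v *)
From HB Require Import structures.
From mathcomp Require Import all_boot all_order all_algebra.
From mathcomp Require Import all_classical all_reals all_analysis.

Set Implicit Arguments.
Unset Strict Implicit.
Unset Printing Implicit Defensive.

Import Order.TTheory GRing.Theory Num.Theory.
Import numFieldTopology.Exports numFieldNormedType.Exports.

Local Open Scope classical_set_scope.
Local Open Scope ring_scope.

Section Dual.
Context {R : realType} {E : topologicalLmodType R}.

Record dual := Dual {
  dual_fun :> E -> R ;
  dual_scalar : scalar dual_fun ;
  dual_continuous : continuous dual_fun }.

Lemma dual_eqP (f g : dual) : f =1 g -> f = g.
Proof.
case: f => f f1 f2; case: g => g g1 g2 /= /funext fg.
by move: f1 f2; rewrite fg => f1 f2; congr Dual; exact: Prop_irrelevance.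
Qed.

HB.instance Definition _ (f : dual) :=
  GRing.isLinear.Build R E R *%R (dual_fun f) (dual_scalar f).

Lemma dual0_scalar : scalar (fun _ : E => 0 : R).
Proof. by move=> a x y; rewrite mulr0 addr0. Qed.

Lemma dual0_continuous : continuous (fun _ : E => 0 : R).
Proof. by move=> x; exact: cvg_cst. Qed.

Lemma dualN_scalar (f : dual) : scalar (fun x => - f x).
Proof. by move=> a x y; rewrite dual_scalar opprD mulrN. Qed.

Lemma dualN_continuous (f : dual) : continuous (fun x => - f x).
Proof. by move=> x; apply: cvgN; exact: dual_continuous. Qed.

Lemma dualD_scalar (f g : dual) : scalar (fun x => f x + g x).
Proof. by move=> a x y; rewrite !dual_scalar mulrDr addrACA. Qed.

Lemma dualD_continuous (f g : dual) : continuous (fun x => f x + g x).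
Proof. by move=> x; apply: cvgD; exact: dual_continuous. Qed.

Lemma dualZ_scalar (c : R) (f : dual) : scalar (fun x => c * f x).
Proof. by move=> a x y; rewrite dual_scalar mulrDr mulrCA. Qed.

Lemma dualZ_continuous (c : R) (f : dual) : continuous (fun x => c * f x).
Proof. by move=> x; apply: cvgM; [exact: cvg_cst|exact: dual_continuous]. Qed.

Definition dual_zero := Dual dual0_scalar dual0_continuous.
Definition dual_opp f := Dual (@dualN_scalar f) (@dualN_continuous f).
Definition dual_add f g := Dual (@dualD_scalar f g) (@dualD_continuous f g).
Definition dual_scale c f := Dual (@dualZ_scalar c f) (@dualZ_continuous c f).

HB.instance Definition _ := gen_eqMixin dual.
HB.instance Definition _ := gen_choiceMixin dual.

Lemma dual_addA : associative dual_add.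
Proof. by move=> f g h; apply: dual_eqP => x /=; rewrite addrA. Qed.
Lemma dual_addC : commutative dual_add.
Proof. by move=> f g; apply: dual_eqP => x /=; rewrite addrC. Qed.
Lemma dual_add0 : left_id dual_zero dual_add.
Proof. by move=> f; apply: dual_eqP => x /=; rewrite add0r. Qed.
Lemma dual_addN : left_inverse dual_zero dual_opp dual_add.
Proof. by move=> f; apply: dual_eqP => x /=; rewrite addNr. Qed.

HB.instance Definition _ :=
  GRing.isZmodule.Build dual dual_addA dual_addC dual_add0 dual_addN.

Lemma dual_scaleA a b f : dual_scale a (dual_scale b f) = dual_scale (a * b) f.
Proof. by apply: dual_eqP => x /=; rewrite mulrA. Qed.
Lemma dual_scale1 : left_id 1 dual_scale.
Proof. by move=> f; apply: dual_eqP => x /=; rewrite mul1r. Qed.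
Lemma dual_scaleDr : right_distributive dual_scale +%R.
Proof. by move=> a f g; apply: dual_eqP => x /=; rewrite mulrDr. Qed.
Lemma dual_scaleDl f : {morph dual_scale^~ f : a b / a + b}.
Proof. by move=> a b; apply: dual_eqP => x /=; rewrite mulrDl. Qed.

HB.instance Definition _ := GRing.Zmodule_isLmodule.Build R dual
  dual_scaleA dual_scale1 dual_scaleDr dual_scaleDl.

(* The topology on [dual] is the weak-* topology: the one induced by the
   pointwise topology on functions E -> R. *)
HB.instance Definition _ :=
  Topological.copy dual (initial_topology (dual_fun : dual -> {ptws E -> R})).

End Dual.

Arguments dual {R} E.
Arguments dual_fun {R E} d x.

(* E with the topology sigma(E, E'), induced by x |-> (phi |-> phi x). *)
Definition weak_space {R : realType} (E : topologicalLmodType R) : Type := E.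

HB.instance Definition _ {R : realType} (E : topologicalLmodType R) :=
  GRing.Lmodule.copy (weak_space E) E.
HB.instance Definition _ {R : realType} (E : topologicalLmodType R) :=
  Topological.copy (weak_space E)
    (initial_topology
       ((fun x phi => dual_fun phi x) : weak_space E -> {ptws dual E -> R})).

Section ContinuousFunctions.
Context {R : realType} {Omega : topologicalType}.

Definition cont_fun : Type := continuousType Omega R.

Lemma cont_fun_eqP (f g : cont_fun) : (f : Omega -> R) =1 g -> f = g.
Proof. by move=> fg; apply/continuousEP. Qed.

Lemma cont_funN_subproof (f : continuousType Omega R) :
  continuous (fun w => - f w).
Proof. by move=> w; apply: cvgN; exact: cts_fun. Qed.

Lemma cont_funD_subproof (f g : continuousType Omega R) :
  continuous (fun w => f w + g w).
Proof. by move=> w; apply: cvgD; exact: cts_fun. Qed.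

Lemma cont_funZ_subproof (c : R) (f : continuousType Omega R) :
  continuous (fun w => c * f w).
Proof. by move=> w; apply: cvgM; [exact: cvg_cst|exact: cts_fun]. Qed.

Definition cont_fun_zero : cont_fun := cst (0 : R) : continuousType Omega R.
Definition cont_fun_opp (f : cont_fun) : cont_fun :=
  mkcts (@cont_funN_subproof f) : continuousType Omega R.
Definition cont_fun_add (f g : cont_fun) : cont_fun :=
  mkcts (@cont_funD_subproof f g) : continuousType Omega R.
Definition cont_fun_scale (c : R) (f : cont_fun) : cont_fun :=
  mkcts (@cont_funZ_subproof c f) : continuousType Omega R.

HB.instance Definition _ := Choice.copy cont_fun (continuousType Omega R).

Lemma cont_fun_addA : associative cont_fun_add.
Proof. by move=> f g h; apply: cont_fun_eqP => w /=; rewrite /mkcts addrA. Qed.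
Lemma cont_fun_addC : commutative cont_fun_add.
Proof. by move=> f g; apply: cont_fun_eqP => w /=; rewrite /mkcts addrC. Qed.
Lemma cont_fun_add0 : left_id cont_fun_zero cont_fun_add.
Proof. by move=> f; apply: cont_fun_eqP => w /=; rewrite /mkcts add0r. Qed.
Lemma cont_fun_addN : left_inverse cont_fun_zero cont_fun_opp cont_fun_add.
Proof. by move=> f; apply: cont_fun_eqP => w /=; rewrite /mkcts addNr. Qed.

HB.instance Definition _ := GRing.isZmodule.Build cont_fun
  cont_fun_addA cont_fun_addC cont_fun_add0 cont_fun_addN.

Lemma cont_fun_scaleA a b f :
  cont_fun_scale a (cont_fun_scale b f) = cont_fun_scale (a * b) f.
Proof. by apply: cont_fun_eqP => w /=; rewrite /mkcts mulrA. Qed.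
Lemma cont_fun_scale1 : left_id 1 cont_fun_scale.
Proof. by move=> f; apply: cont_fun_eqP => w /=; rewrite /mkcts mul1r. Qed.
Lemma cont_fun_scaleDr : right_distributive cont_fun_scale +%R.
Proof. by move=> a f g; apply: cont_fun_eqP => w /=; rewrite /mkcts mulrDr. Qed.
Lemma cont_fun_scaleDl f : {morph cont_fun_scale^~ f : a b / a + b}.
Proof. by move=> a b; apply: cont_fun_eqP => w /=; rewrite /mkcts mulrDl. Qed.

HB.instance Definition _ := GRing.Zmodule_isLmodule.Build R cont_fun
  cont_fun_scaleA cont_fun_scale1 cont_fun_scaleDr cont_fun_scaleDl.

End ContinuousFunctions.

Arguments cont_fun R Omega : clear implicits.

Definition eval_cont {R : realType} {Omega : topologicalType}
  (f : cont_fun R Omega) : Omega -> R := (f : continuousType Omega R).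

Definition C_p (R : realType) (Omega : topologicalType) : Type :=
  cont_fun R Omega.
Definition C_k (R : realType) (Omega : topologicalType) : Type :=
  cont_fun R Omega.

HB.instance Definition _ (R : realType) (Omega : topologicalType) :=
  GRing.Lmodule.copy (C_p R Omega) (cont_fun R Omega).
HB.instance Definition _ (R : realType) (Omega : topologicalType) :=
  Topological.copy (C_p R Omega)
    (initial_topology (eval_cont : C_p R Omega -> {ptws Omega -> R})).

HB.instance Definition _ (R : realType) (Omega : topologicalType) :=
  GRing.Lmodule.copy (C_k R Omega) (cont_fun R Omega).
HB.instance Definition _ (R : realType) (Omega : topologicalType) :=
  Topological.copy (C_k R Omega)
    (initial_topology (eval_cont : C_k R Omega -> {family compact, Omega -> R})).

Record representation {R : realType} (E : topologicalLmodType R)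
    (Omega : topologicalType) := Representation {
  rep_fun :> {linear E -> C_p R Omega} ;
  rep_continuous : continuous rep_fun }.

Section TopologicalVectorSpaces.
Context {R : realType}.

Definition separates_points {E : topologicalLmodType R} (S : set (dual E)) :=
  forall x : E, x != 0 -> exists2 phi, S phi & phi x != 0.

Definition equicontinuous_set {E : topologicalLmodType R} (S : set (dual E)) :=
  forall eps : R, 0 < eps ->
    exists2 U : set E, nbhs 0 U & forall u phi, U u -> S phi -> `|phi u| < eps.

Definition locally_convex_space (E : topologicalLmodType R) :=
  exists2 B : set_system E, (forall b, b \in B -> convex_set b) & basis B.

(* von Neumann boundedness *)
Definition tvs_bounded {V : preTopologicalLmodType R} (A : set V) :=
  forall U : set V, nbhs 0 U ->
    exists2 r : R, 0 < r & forall t, r < t -> A `<=` [set t *: u | u in U].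

Definition barrelled_space (E : topologicalLmodType R) :=
  locally_convex_space E /\
  forall S : set (dual E), tvs_bounded S -> equicontinuous_set S.

Definition metrizable_space (X : topologicalType) :=
  exists d : X -> X -> R,
    [/\ forall x y, (d x y == 0) = (x == y),
        forall x y, d x y = d y x,
        forall x y z, d x z <= d x y + d y z &
        forall x (A : set X), nbhs x A <->
          exists2 e : R, 0 < e & [set y | d x y < e] `<=` A].

(* Completeness for the translation-invariant uniformity of E. *)
Definition complete_space (E : topologicalLmodType R) :=
  forall F : set_system E, ProperFilter F ->
    (forall U : set E, nbhs 0 U ->
       exists2 A, F A & forall x y, A x -> A y -> U (x - y)) ->
    exists x : E, F --> x.

Definition frechet_space (E : topologicalLmodType R) :=
  [/\ locally_convex_space E, metrizable_space E & complete_space E].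

End TopologicalVectorSpaces.

Section Cones.
Context {R : realType}.

Definition convex_cone {V : lmodType R} (K : set V) :=
  [/\ K !=set0,
      forall x y, K x -> K y -> K (x + y) &
      forall (c : R) x, 0 <= c -> K x -> K (c *: x)].

Definition cone_generated {V : lmodType R} (M : set V) : set V :=
  [set x | exists (n : nat) (c : 'I_n -> R) (v : 'I_n -> V),
     [/\ forall i, 0 <= c i, forall i, M (v i) & x = \sum_i c i *: v i]].

Definition positive_map {V W : lmodType R} (K : set V) (L : set W)
  (T : V -> W) := T @` K `<=` L.

Definition bipositive_map {V W : lmodType R} (K : set V) (L : set W)
  (T : V -> W) := K = T @^-1` L.

Definition nonneg_functions {Omega : topologicalType} : set (C_p R Omega) :=
  [set f | forall w, 0 <= eval_cont f w].

Definition dual_cone {E : topologicalLmodType R} (K : set E) : set (dual E) :=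
  [set phi | forall x, K x -> 0 <= phi x].

End Cones.

(* Main.v *)
Require Import Defs.
From HB Require Import structures.
From mathcomp Require Import all_boot all_order all_algebra.
From mathcomp Require Import all_classical all_reals all_analysis.
From mathcomp Require Import ring lra.

Set Implicit Arguments.
Unset Strict Implicit.
Unset Printing Implicit Defensive.

Import Order.TTheory GRing.Theory Num.Theory.
Import numFieldTopology.Exports numFieldNormedType.Exports.

Local Open Scope classical_set_scope.
Local Open Scope ring_scope.

(** The transpose of T sends w to the functional x |-> T x w.  Both the weak-*
topology of the dual and the topology of [C_p] are initial for evaluations, so
each continuity claim made in (a) says that (x, w) |-> T x w is separately
continuous; this is why transposition is a bijection.  Injectivity and
positivity of T are pointwise conditions on (x, w), which can be read off
either side.

For (c), a basic neighbourhood for the topology of compact convergence bounds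
[T x] uniformly on a compact set K, which is precisely what equicontinuity of
the image of K demands ([Ck_continuous_equicontinuous]).  The image of K is
always bounded at each point x, because [T x] is continuous on K.  Over a
barrelled space this is enough for equicontinuity.  Over a Frechet space it is
enough by the uniform boundedness principle
([complete_metrizable_banach_steinhaus]): were the functionals not
equicontinuous, a series of small vectors on which chosen functionals take
ever larger values would converge, by completeness, to a point at which the
set is unbounded.

For (e), the half-spaces given by the transpose cut out the preimage of the
cone of nonnegative functions, and the equivalence is the bipolar theorem,
applied to a weakly closed cone in E and to a weak-* closed cone in the dual.
The separation behind it takes place in finite dimension: a neighbourhood for
an initial topology of evaluations involves finitely many of them
([nbhs_initial_ptws]), so a point outside the closure of a cone is already
outside the closure of the image of the cone under finitely many evaluations
([cone_separation_initial]).  There a closest point of the closed cone yields a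
separating linear form ([cone_separation_rV]). *)

(** * Separation from a cone in finite dimension *)

(** Dividing by t and letting t tend to 0 leaves 2 x. *)
Lemma ge0_of_quadratic (R : realType) (x y : R) :
  (forall t, 0 <= t <= 1 -> 0 <= 2 * t * x + t ^+ 2 * y) -> 0 <= x.
Proof.
move=> H; rewrite leNgt; apply/negP => x0.
have y0 : 0 < y by have := H 1; lra.
have yx : 0 < y - x by lra.
(* The value t = - x / (y - x) lies in [0, 1] and makes 2 x + t y negative. *)
have t0 : 0 <= - x / (y - x) by apply: divr_ge0; lra.
have t1 : - x / (y - x) <= 1 by rewrite ler_pdivrMr //; lra.
have : (- x / (y - x)) * (y - x) = - x by rewrite divfK // gt_eqF.
have := H (- x / (y - x)); rewrite t0 t1 => /(_ erefl).
set t := - x / (y - x) in t0 t1 *; nra.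
Qed.

Lemma closure_homo (X Y : topologicalType) (f : X -> Y) (A : set X) (B : set Y)
    (x : X) :
  {for x, continuous f} -> (forall a, A a -> B (f a)) ->
  closure A x -> closure B (f x).
Proof.
move=> fx AB Ax U /fx /Ax [a [Aa Ua]]; exists (f a); split => //; exact: AB.
Qed.

Section SquaredDistance.
Context {R : realType} {n : nat}.
Implicit Types (u v p : 'rV[R]_n).

Definition dot u v := \sum_i u 0 i * v 0 i.
Definition sqdist p u := dot (u - p) (u - p).

Lemma sqdist_continuous p : continuous (sqdist p : 'rV[R]_n -> R).
Proof.
rewrite /sqdist /dot; apply: continuous_big => [|i _ u].
  exact: add_continuous.
have cu : (fun v : 'rV[R]_n => v 0 i - p 0 i) @ u --> u 0 i - p 0 i.
  exact: (cvgB (@coord_continuous R 1 n 0 i u) (cvg_cst (p 0 i))).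
rewrite (_ : (fun v => _) = (fun v => (v 0 i - p 0 i) * (v 0 i - p 0 i))).
  exact: (cvgM cu cu).
by apply/funext => v; rewrite !mxE.
Qed.

Lemma dot_ge0 u : 0 <= dot u u.
Proof. by apply: sumr_ge0 => i _; rewrite -expr2 sqr_ge0. Qed.

Lemma sqr_coord_le_dot u i : u 0 i ^+ 2 <= dot u u.
Proof.
rewrite /dot (bigD1 i) //= expr2 lerDl.
by apply: sumr_ge0 => j _; rewrite -expr2 sqr_ge0.
Qed.

Lemma dotBr u v w : dot u (v - w) = dot u v - dot u w.
Proof.
by rewrite /dot -sumrB; apply: eq_bigr => i _; rewrite !mxE mulrBr.
Qed.

Lemma dotNr u v : dot u (- v) = - dot u v.
Proof. by rewrite -[- v]add0r dotBr [dot u 0]big1 ?sub0r// => i _; rewrite mxE mulr0. Qed.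

Lemma sqdist_move p u v t :
  sqdist p (u + t *: v) = sqdist p u + 2 * t * dot (u - p) v + t ^+ 2 * dot v v.
Proof.
rewrite /sqdist /dot !mulr_sumr -!big_split /=; apply: eq_bigr => i _.
by rewrite !mxE; ring.
Qed.

Lemma compact_sqdist_sublevel p r : compact [set u | sqdist p u <= r].
Proof.
apply: (@subclosed_compact _ _
    [set u : 'rV[R]_n | forall i, `[p 0 i - (r + 1), p 0 i + (r + 1)]%classic (u ord0 i)]).
- apply: (preimage_closed _ (@closed_le R r)) => u _.
  exact: sqdist_continuous.
- by apply: (@rV_compact _ _ (fun i => `[p 0 i - (r + 1), p 0 i + (r + 1)]%classic)) => i;
    exact: segment_compact.
- move=> u /= ur i; rewrite in_itv /=.
  have := le_trans (sqr_coord_le_dot (u - p) i) ur; rewrite !mxE => h.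
  have r0 := le_trans (sqr_ge0 _) h.
  have hp := sqr_ge0 (u 0 i - p 0 i + 1).
  have hm := sqr_ge0 (u 0 i - p 0 i - 1).
  by apply/andP; split; lra.
Qed.

(** Let c be the point of the closure of K closest to p, and a := c - p.  Moving
from c in a direction v that stays in the closure cannot decrease the distance
to p, whence 0 <= dot a v.  The elements of K are such directions, and so is
- c; the latter gives dot a c <= 0, hence dot a p <= - dot a a < 0. *)
Lemma cone_separation_rV (K : set 'rV[R]_n) p : convex_cone K -> ~ closure K p ->
  exists a, (forall k, K k -> 0 <= dot a k) /\ dot a p < 0.
Proof.
move=> [[k0 Kk0] KD KZ] pK.
have K0 : K 0 by rewrite -(scale0r k0); exact: KZ.
(* The closest point is sought among those no farther from p than 0 is, which
   form a compact set. *)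
pose A := closure K `&` [set u | sqdist p u <= sqdist p 0].
have A0 : A 0 by split; [exact: subset_closure|exact: lexx].
have cA : compact A.
  apply: (@subclosed_compact _ _ [set u | sqdist p u <= sqdist p 0]).
  - apply: closedI; first exact: closed_closure.
    by apply: (preimage_closed _ (@closed_le R (sqdist p 0))) => u _;
      exact: sqdist_continuous.
  - exact: compact_sqdist_sublevel.
  - by move=> u [].
have [c /set_mem [Kc c0] cmin] : exists2 c, c \in A &
    forall u, u \in A -> sqdist p c <= sqdist p u.
  apply: EVT_min_rV => //; first by exists 0.
  exact/continuous_subspaceT/sqdist_continuous.
have cminK u : closure K u -> sqdist p c <= sqdist p u.
  move=> Ku; have [ule|ult] := leP (sqdist p u) (sqdist p 0).
    by apply: cmin; apply/mem_set.
  exact: le_trans c0 (ltW ult).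
(* first-order optimality of c in the directions that stay in the closure *)
have var v : (forall t, 0 <= t <= 1 -> closure K (c + t *: v)) ->
    0 <= dot (c - p) v.
  move=> Kv; apply: (@ge0_of_quadratic _ _ (dot v v)) => t t01.
  by have := cminK _ (Kv t t01); rewrite sqdist_move -addrA lerDl.
exists (c - p); split=> [k Kk|].
  apply: var => t /andP[t0 _].
  apply: (@closure_homo _ _ (fun u => u + t *: k) K) => //.
    exact: (@cvgD _ _ _ (nbhs c) _ id _ _ _ cvg_id (cvg_cst (t *: k))).
  by move=> u Ku; apply: KD => //; exact: KZ.
have : 0 <= dot (c - p) (- c).
  apply: var => t /andP[_ t1].
  rewrite -{1}[c]scale1r scalerN -scalerBl.
  apply: (@closure_homo _ _ (fun u => (1 - t) *: u) K) => //.
    exact: (@cvgZ _ _ _ (nbhs c) _ _ id _ _ (cvg_cst (1 - t)) cvg_id).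
  by move=> u Ku; apply: KZ => //; rewrite subr_ge0.
rewrite dotNr oppr_ge0 => cpc.
have cp : 0 < dot (c - p) (c - p).
  rewrite lt_neqAle dot_ge0 andbT; apply/eqP => cp0; apply: pK.
  suff -> : p = c by [].
  apply/rowP => i; apply/esym/eqP; rewrite -subr_eq0 -sqrf_eq0.
  have := sqr_coord_le_dot (c - p) i; rewrite -cp0 !mxE => le0.
  by rewrite eq_le le0 sqr_ge0.
by move: cp; rewrite dotBr; lra.
Qed.

End SquaredDistance.

(** * Initial topologies of evaluations *)

Section PointwiseTopology.
Context {R : realType} {X : choiceType} {I : topologicalType}.
Context (g : X -> {ptws I -> R}).
Implicit Types x : initial_topology g.

Definition finite_window (f : I -> R) (A : set (I -> R)) :=
  exists (s : seq I) (e : R), 0 < e /\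
    forall h : I -> R, (forall i, i \in s -> `|h i - f i| < e) -> A h.

Lemma finite_window_filter f : Filter (finite_window f).
Proof.
split.
- by exists [::], 1.
- move=> A B [s [e [e0 sA]]] [t [d [d0 tB]]].
  exists (s ++ t), (Num.min e d); rewrite lt_min e0 d0; split => // h hst.
  split; [apply: sA|apply: tB] => i it;
    by have := hst i; rewrite mem_cat it ?orbT lt_min => /(_ erefl) /andP[].
- by move=> A B AB [s [e [e0 sA]]]; exists s, e; split => // h /sA /AB.
Qed.

(** The filter generated by the finite windows around [g x] converges to [g x] in
every coordinate, hence pointwise; so it contains every neighbourhood of
[g x]. *)
Lemma nbhs_initial_ptws x (U : set X) : nbhs x U ->
  exists (s : seq I) (e : R), 0 < e /\
    forall y, (forall i, i \in s -> `|g y i - g x i| < e) -> U y.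
Proof.
move=> [_ [[W oW <-] Wx] WU].
have FF := finite_window_filter (g x).
have : {ptws, finite_window (g x) --> (g x : I -> R)}.
  apply/pointwise_cvgP => i; apply/cvgrPdistC_lt => e e0.
  by exists [:: i], e; split => // h; apply; rewrite inE.
move=> /(_ W (open_nbhs_nbhs (conj oW Wx))) [s [e [e0 sW]]].
by exists s, e; split => // y ys; apply: WU; exact: sW.
Qed.

Lemma coord_initial_continuous i : continuous (fun x => g x i : R).
Proof.
move=> x.
exact: (@continuous_comp _ _ _ (g : initial_topology g -> {ptws I -> R})
  (fun h => h i) x (initial_continuous (x := x))
  (@proj_continuous I (fun=> R) i (g x))).
Qed.

Lemma continuous_initial_ptws (Y : topologicalType) (f : Y -> initial_topology g) :
  continuous f <-> forall i, continuous (fun y => g (f y) i : R).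
Proof.
split=> [cf i y|cf]; last first.
  apply: continuous_comp_initial => y; apply/pointwise_cvgP => i; exact: cf.
exact: (continuous_comp (cf y) (@coord_initial_continuous i (f y))).
Qed.

End PointwiseTopology.

(** * Separation for the weak and weak-* topologies *)

Section Pairing.
Context {R : realType} {V : lmodType R} {I : topologicalType}.
Context (b : V -> {ptws I -> R}) (b_scalar : forall i, scalar (b^~ i : V -> R)).

(** Some neighbourhood of p that misses K is defined by finitely many
coordinates; in these coordinates p stays away from the cone K, and separation
takes place in a finite-dimensional space. *)
Lemma cone_separation_initial (K : set (initial_topology b)) (p : V) :
  @convex_cone R V K -> ~ closure K p ->
  exists (n : nat) (x : 'I_n -> I) (a : 'I_n -> R),
    (forall k, K k -> 0 <= \sum_j a j * b k (x j)) /\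
    \sum_j a j * b p (x j) < 0.
Proof.
move=> [[k0 Kk0] KD KZ] /existsNP[U /not_implyP[/nbhs_initial_ptws[s [e [e0 sU]]] KU]].
pose x := tnth (in_tuple s).
pose coords v : 'rV[R]_(size s) := \row_j b v (x j).
have coordsD a u v : coords (a *: u + v) = a *: coords u + coords v.
  by apply/rowP => j; rewrite !mxE b_scalar.
have cone : convex_cone (coords @` K).
  split; first by exists (coords k0); exists k0.
    move=> _ _ [u Ku <-] [v Kv <-]; exists (u + v); first exact: KD.
    by rewrite -{1}[u]scale1r coordsD scale1r.
  move=> c _ c0 [u Ku <-]; exists (c *: u); first exact: KZ.
  have -> : c *: u = (c - 1) *: u + u by rewrite scalerBl scale1r subrK.
  by rewrite coordsD scalerBl scale1r subrK.
have far : ~ closure (coords @` K) (coords p).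
  move=> /(_ _ (nbhsx_ballx _ _ e0)) [_ [[k Kk <-] [_ near]]].
  apply: KU; exists k; split => //; apply: sU => i /(tnthP (in_tuple s)) [j ->].
  by have := near 0 j; rewrite !mxE /ball /= distrC.
have [a [aK ap]] := cone_separation_rV cone far.
have dotE v : dot a (coords v) = \sum_j a 0 j * b v (x j).
  by apply: eq_bigr => j _; rewrite mxE.
exists (size s), x, (a 0); split=> [k Kk|]; last by rewrite -dotE.
by rewrite -dotE; apply: aK; exists k.
Qed.

End Pairing.

Section DualSeparation.
Context {R : realType} {E : topologicalLmodType R}.
Implicit Types (phi psi : dual E) (x : E).

Lemma dual_sumE n (a : 'I_n -> R) (psi : 'I_n -> dual E) x :
  (\sum_j a j *: psi j) x = \sum_j a j * psi j x.
Proof.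
by elim/big_ind2 : _ => // [f r g t fr gt]; rewrite -fr -gt.
Qed.

Lemma dual_sum_arg phi n (a : 'I_n -> R) (x : 'I_n -> E) :
  phi (\sum_j a j *: x j) = \sum_j a j * phi (x j).
Proof. by rewrite linear_sum; apply: eq_bigr => j _; rewrite linearZ. Qed.

(** The separating combination of evaluations at elements of the dual is itself
an element of the dual. *)
Lemma weakly_closed_cone_separation (K : set E) x :
  convex_cone K -> closed (K : set (weak_space E)) -> ~ K x ->
  exists2 phi, dual_cone K phi & phi x < 0.
Proof.
move=> Kcone Kclosed Kx.
have lin (phi : dual E) : scalar (fun x : E => phi x) by exact: dual_scalar.
have [|n [psi [a [aK ax]]]] := cone_separation_initial lin Kcone (p := x).
  by move=> /(Kclosed (x : weak_space E)).
by exists (\sum_j a j *: psi j) => [k Kk|]; rewrite dual_sumE //; exact: aK.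
Qed.

(** The separating combination of evaluations at points of E is the evaluation at
one point, because functionals are linear. *)
Lemma weakstar_cone_separation (C : set (dual E)) phi :
  convex_cone C -> ~ closure C phi ->
  exists x, (forall psi, C psi -> 0 <= psi x) /\ phi x < 0.
Proof.
move=> Ccone Cphi.
have lin x : scalar (fun psi : dual E => psi x) by [].
have [n [y [a [aC ay]]]] := cone_separation_initial lin Ccone Cphi.
exists (\sum_j a j *: y j); split=> [psi Cpsi|]; rewrite dual_sum_arg //.
exact: aC.
Qed.

End DualSeparation.

(** * Dual cones and generated cones *)

Section GeneratedCone.
Context {R : realType}.

Lemma cone_generated_sub (V : lmodType R) (M : set V) : M `<=` cone_generated M.
Proof.
move=> v Mv; exists 1, (fun=> 1), (fun=> v); split => //.
by rewrite big_ord1 scale1r.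
Qed.

Lemma cone_generated_convex (V : lmodType R) (M : set V) : convex_cone (cone_generated M).
Proof.
split.
- by exists 0; exists 0, (fun=> 0), (fun=> 0); split; [by []|by case|by rewrite big_ord0].
- move=> _ _ [m [c [v [c0 Mv ->]]]] [n [d [w [d0 Mw ->]]]].
  exists (m + n).
  exists (fun i : 'I_(m + n) =>
    match fintype.split i with inl j => c j | inr j => d j end).
  exists (fun i : 'I_(m + n) =>
    match fintype.split i with inl j => v j | inr j => w j end).
  split=> [i|i|]; [by case: fintype.split|by case: fintype.split|].
  rewrite big_split_ord; congr (_ + _); apply: eq_bigr => i _.
    by rewrite (unsplitK (inl i)).
  by rewrite (unsplitK (inr i)).
- move=> a _ a0 [n [c [v [c0 Mv ->]]]]; exists n, (fun i => a * c i), v.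
  split=> // [i|]; first exact: mulr_ge0.
  by rewrite scaler_sumr; apply: eq_bigr => i _; rewrite scalerA.
Qed.

Context {E : topologicalLmodType R}.
Implicit Types (K : set E) (M : set (dual E)).

Lemma cone_generated_dual_cone M K :
  M `<=` dual_cone K -> cone_generated M `<=` dual_cone K.
Proof.
move=> MK _ [n [c [psi [c0 Mpsi ->]]]] x Kx; rewrite dual_sumE.
by apply: sumr_ge0 => j _; apply: mulr_ge0 => //; exact: MK.
Qed.

Lemma closure_ge0 (X : topologicalType) (f : X -> R) (A : set X) x :
  continuous f -> (forall a, A a -> 0 <= f a) -> closure A x -> 0 <= f x.
Proof.
move=> cf Af /(@closure_homo X R f A [set r | 0 <= r] x (cf x) Af).
by rewrite -(closure_id _).1 //; exact: closed_ge.
Qed.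

Lemma closure_dual_cone M K : M `<=` dual_cone K -> closure M `<=` dual_cone K.
Proof.
move=> MK phi Mphi x Kx.
apply: (closure_ge0 (@coord_initial_continuous _ _ _ (dual_fun : dual E -> {ptws E -> R}) x) _ Mphi).
by move=> psi /MK; exact.
Qed.

End GeneratedCone.

(** * Bounded sets of functionals and equicontinuity *)

Section TopologicalVectorSpace.
Context {R : realType} {E : topologicalLmodType R}.
Implicit Types (x y u v : E) (U W : set E) (phi : dual E) (S : set (dual E)).

Lemma nbhs0_scale (c : R) W : nbhs 0 W -> nbhs 0 [set u | W (c *: u)].
Proof.
move=> W0; have := @scale_continuous R E (c, 0) W; rewrite /= scaler0.
move=> /(_ W0) [[A B] /= [nA nB] AB]; apply: filterS nB => u Bu.
exact: (AB (c, u) (conj (nbhs_singleton nA) Bu)).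
Qed.

Lemma nbhs_translate x W : nbhs 0 W -> nbhs x [set y | W (y - x)].
Proof.
move=> W0; have := @sub_continuous E (x, x) W; rewrite /= subrr.
move=> /(_ W0) [[A B] /= [nA nB] AB]; apply: filterS nA => y Ay.
exact: (AB (y, x) (conj Ay (nbhs_singleton nB))).
Qed.

Lemma nbhs0_add W : nbhs 0 W ->
  exists2 U, nbhs 0 U & forall u v, U u -> U v -> W (u + v).
Proof.
move=> W0; have := @add_continuous E (0, 0) W; rewrite /= addr0.
move=> /(_ W0) [[A B] /= [nA nB] AB]; exists (A `&` B); first exact: filterI.
by move=> u v [Au _] [_ Bv]; exact: (AB (u, v) (conj Au Bv)).
Qed.

Lemma nbhs0_sub W : nbhs 0 W ->
  exists2 U, nbhs 0 U & forall u v, U u -> U v -> W (u - v).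
Proof.
move=> W0; have := @sub_continuous E (0, 0) W; rewrite /= subrr.
move=> /(_ W0) [[A B] /= [nA nB] AB]; exists (A `&` B); first exact: filterI.
by move=> u v [Au _] [_ Bv]; exact: (AB (u, v) (conj Au Bv)).
Qed.

Lemma nbhs_dual_lt phi x (e : R) : 0 < e -> nbhs x [set y | `|phi y - phi x| < e].
Proof.
move=> e0; have /cvgrPdistC_lt := @dual_continuous R E phi x.
exact.
Qed.

(** Boundedness for the weak-* topology, spelled out through evaluations. *)
Definition simply_bounded S := forall x, exists M : R,
  forall phi, S phi -> `|phi x| <= M.

Lemma metrizable_nbhs0_basis : @metrizable_space R E ->
  exists B : nat -> set E, (forall n, nbhs 0 (B n)) /\
    forall W, nbhs 0 W -> exists n, B n `<=` W.
Proof.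
move=> [d [_ _ _ dnbhs]]; exists (fun n => [set y | d 0 y < n.+1%:R^-1]).
split=> [n|W /dnbhs [e e0 eW]].
  by apply/dnbhs; exists n.+1%:R^-1 => //; rewrite invr_gt0.
exists (Num.truncn e^-1) => y /= yn; apply: eW => /=; apply: lt_trans yn _.
by rewrite -[ltRHS]invrK ltf_pV2 ?posrE ?invr_gt0 // truncnS_gt.
Qed.

(** Rescaling turns a fixed lower bound on arbitrarily small vectors into
arbitrarily large lower bounds on arbitrarily small vectors. *)
Lemma not_equicontinuous_unbounded S : ~ equicontinuous_set S ->
  forall W (C : R), nbhs 0 W -> exists u phi, [/\ W u, S phi & C <= `|phi u|].
Proof.
move=> /existsNP[e /not_implyP[e0 Se]] W C W0; apply: contrapT => noW.
apply: Se; pose c := (`|C| + 1) / e.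
have c0 : 0 < c by rewrite divr_gt0 // ltr_wpDl.
exists [set u | W (c *: u)]; first exact: nbhs0_scale.
move=> u phi /= Wcu Sphi; rewrite ltNge; apply/negP => ephi; apply: noW.
exists (c *: u), phi; split => //.
rewrite linearZ normrM (gtr0_norm c0).
apply: (@le_trans _ _ (c * e)); last by rewrite ler_pM2l.
by rewrite divfK ?gt_eqF //; have := ler_norm C; lra.
Qed.

(** If S is not equicontinuous, build points [s n] and neighbourhoods [V n] of 0
such that the sets s n + V n decrease, [V n.+1] lies in the n-th basic
neighbourhood, and some phi in S has modulus at least n + 1 at [s n.+1] and at
most 1 on [V n.+1].  Then s is a Cauchy sequence, and at its limit that phi
still has modulus at least n - 1, which contradicts boundedness at the limit. *)
Lemma complete_metrizable_banach_steinhaus S :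
  complete_space E -> @metrizable_space R E ->
  simply_bounded S -> equicontinuous_set S.
Proof.
move=> Ecomplete /metrizable_nbhs0_basis[B [B0 Bbasis]] Sbd.
apply: contrapT => /not_equicontinuous_unbounded Sunbd.
(* p = (s n, V n) and q = (s n.+1, V n.+1) *)
pose refines n (p q : E * set E) :=
  [/\ nbhs 0 q.2, q.2 `<=` B n, (forall v, q.2 v -> p.2 (q.1 - p.1 + v)) &
    exists2 phi, S phi & n%:R + 1 <= `|phi q.1| /\
      forall v, q.2 v -> `|phi v| <= 1].
have step (np : nat * (E * set E)) : exists q, nbhs 0 np.2.2 -> refines np.1 np.2 q.
  case: np => n [s V] /=; have [V0|] := pselect (nbhs 0 V); last by exists (0, V).
  have [W W0 WV] := nbhs0_add V0.
  have [M SM] := Sbd s.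
  have [u [phi [Wu Sphi uphi]]] := Sunbd W (M + n%:R + 1) W0.
  exists (s + u, (W `&` B n) `&` [set v | `|phi v - phi 0| < 1]) => _.
  split => /=.
  - by apply: filterI; [exact: filterI|exact: nbhs_dual_lt].
  - by move=> v [[]].
  - by move=> v [[Wv _] _]; rewrite [s + u]addrC addrK; exact: WV.
  - exists phi => //; split; last first.
      by move=> v [_] /=; rewrite linear0 subr0 => /ltW.
    rewrite linearD.
    have := ler_normB (phi s + phi u) (phi s).
    rewrite [phi s + _]addrC addrK => h.
    by have := SM _ Sphi; lra.
have [next nextP] := choice step.
pose st := fix st n := if n is m.+1 then next (m, st m) else (0, setT).
pose s n := (st n).1; pose V n := (st n).2.
have V0 n : nbhs 0 (V n).
  elim: n => [|n V0]; first exact: filterT.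
  by have [] := nextP (n, st n) V0.
have stP n : refines n (st n) (st n.+1) by exact: (nextP (n, st n) (V0 n)).
have tail m n : V n (s (n + m)%N - s n).
  elim: m n => [|m IH] n.
    by rewrite addn0 subrr; exact: nbhs_singleton.
  have [_ _ /(_ _ (IH n.+1)) + _] := stP n.
  by rewrite -/(s n) -/(s n.+1) -/(V n) addrC addrA subrK addSnnS.
have tail_near N : \forall m \near \oo, V N (s m - s N).
  by exists N => // m /= Nm; rewrite -(subnKC Nm).
have [|x sx] := Ecomplete (s @ \oo) _.
  move=> U /nbhs0_sub [W W0 WU]; have [N BW] := Bbasis W W0.
  exists [set y | V N.+1 (y - s N.+1)]; first exact: tail_near.
  move=> y z /= Vy Vz; have [_ VB _ _] := stP N.
  rewrite -[y - z](subrKA (s N.+1)) -[s N.+1 - z]opprB.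
  by apply: WU; apply: BW; apply: VB.
have [M SM] := Sbd x.
(* Passing from s n.+1 to s m costs 1 and from s m to x another 1; hence the
   margin 2. *)
pose n := Num.truncn (`|M| + 2).
have [_ _ _ [phi Sphi [sphi Vphi]]] := stP n.
have : \forall m \near \oo, `|phi (s m) - phi x| < 1.
  exact: (sx _ (nbhs_dual_lt phi x ltr01)).
move=> /(filterI (tail_near n.+1)) /filter_ex [m [/Vphi]].
rewrite linearB -/(s n.+1) in sphi *.
have := SM _ Sphi; have := truncnS_gt (`|M| + 2); rewrite -/n -natr1.
have := ler_norm M.
have := ler_normB (phi (s m)) (phi (s m) - phi (s n.+1)).
have := ler_normD (phi (s m) - phi x) (phi x).
rewrite subKr subrK; lra.
Qed.

End TopologicalVectorSpace.

(** A weak-* neighbourhood of 0 involves finitely many evaluations, and on these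
finitely many points the set has a common bound M; any dilation factor above
M / e then suffices. *)
Lemma simply_bounded_tvs_bounded (R : realType) (E : topologicalLmodType R)
  (S : set (dual E)) : simply_bounded S -> tvs_bounded S.
Proof.
move=> Sbd U /(@nbhs_initial_ptws _ _ _ (dual_fun : dual E -> {ptws E -> R})).
move=> [s [e [e0 sU]]].
have [M M0 SM] : exists2 M : R, 0 <= M &
    forall x phi, x \in s -> S phi -> `|phi x| <= M.
  elim: s {sU} => [|x s [M M0 SM]]; first by exists 0.
  have [N SN] := Sbd x; exists (Num.max M N); first by rewrite le_max M0.
  move=> y phi; rewrite inE le_max => /predU1P[->|ys] Sphi.
    by rewrite SN ?orbT.
  by rewrite SM.
exists (M / e + 1); first by rewrite ltr_wpDl // divr_ge0 // ltW.
move=> t rt phi Sphi.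
have t0 : 0 < t by apply: lt_trans rt; rewrite ltr_wpDl // divr_ge0 // ltW.
exists (t^-1 *: phi); last by rewrite scalerA divff ?gt_eqF // scale1r.
apply: sU => x xs.
rewrite [dual_fun 0 x](_ : _ = 0) // subr0 [dual_fun _ x](_ : _ = t^-1 * phi x) //.
rewrite normrM gtr0_norm ?invr_gt0 // mulrC ltr_pdivrMr //.
apply: le_lt_trans (SM _ _ xs Sphi) _.
by rewrite mulrC -ltr_pdivrMr //; lra.
Qed.

(** * The transpose of a representation *)

Section Transpose.
Context {R : realType} {E : topologicalLmodType R} {Omega : topologicalType}.
Implicit Types T : representation E Omega.

Lemma eval_cont_linear (a : R) (f g : C_p R Omega) w :
  eval_cont (a *: f + g) w = a * eval_cont f w + eval_cont g w.
Proof. by []. Qed.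

Lemma rep_eval_scalar T w : scalar (fun x => eval_cont (T x) w).
Proof. by move=> a x y; rewrite linearP eval_cont_linear. Qed.

Lemma rep_eval_continuous T w : continuous (fun x => eval_cont (T x) w : R).
Proof.
by move: w; apply/(continuous_initial_ptws (g := eval_cont)); exact: rep_continuous.
Qed.

Definition transpose_at T w : dual E :=
  Dual (rep_eval_scalar T w) (@rep_eval_continuous T w).

Lemma transpose_at_continuous T : continuous (transpose_at T).
Proof.
apply/(continuous_initial_ptws (g := dual_fun)) => x w.
exact: (@cts_fun _ _ (T x : continuousType Omega R)).
Qed.

Definition transpose T : continuousType Omega (dual E) :=
  mkcts (@transpose_at_continuous T).

Section Untranspose.
Context (f : continuousType Omega (dual E)).

Lemma untranspose_at_continuous x : continuous (fun w => f w x : R).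
Proof.
move=> w; exact: (continuous_comp (@cts_fun _ _ f w)
  (coord_initial_continuous (g := dual_fun) (i := x) (x := f w))).
Qed.

Definition untranspose_fun (x : E) : C_p R Omega :=
  (mkcts (@untranspose_at_continuous x) : continuousType Omega R).

Lemma untranspose_linear : linear untranspose_fun.
Proof. by move=> a x y; apply: cont_fun_eqP => w; exact: (dual_scalar (f w)). Qed.

HB.instance Definition _ :=
  GRing.isLinear.Build R E (C_p R Omega) *:%R untranspose_fun untranspose_linear.

Lemma untranspose_continuous : continuous untranspose_fun.
Proof.
apply/(continuous_initial_ptws (g := eval_cont)) => w.
exact: (@dual_continuous R E (f w)).
Qed.

Definition untranspose : representation E Omega :=
  @Representation _ _ _ (untranspose_fun : {linear E -> C_p R Omega}) untranspose_continuous.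

End Untranspose.

(** A representation carries, beyond its values, only proofs. *)
Lemma representation_eqP T T' : (forall x, T x = T' x) -> T = T'.
Proof.
case: T T' => [[t [[tB] [tZ]]] ct] [[u [[uB] [uZ]]] cu] /= /funext tu.
subst u; move: ct cu; rewrite (Prop_irrelevance uB tB) (Prop_irrelevance uZ tZ).
by move=> ct cu; rewrite (Prop_irrelevance ct cu).
Qed.

Lemma transpose_bijective : bijective transpose.
Proof.
exists untranspose => [T|f].
  by apply: representation_eqP => x; apply: cont_fun_eqP.
by apply/continuousEP => w; apply: dual_eqP.
Qed.

Lemma injective_separates T : injective T <-> separates_points (range (transpose T)).
Proof.
split=> [Tinj x|Tsep x y Txy].
  move=> /eqP x0; apply: contrapT => noT; apply: x0; apply: Tinj; rewrite linear0.
  apply: cont_fun_eqP => w; apply: contrapT => Tx; apply: noT.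
  by exists (transpose T w); [exists w|apply/eqP].
apply/eqP; rewrite -subr_eq0; apply: contrapT => /negP /Tsep[_ [w _ <-]] /negP.
by apply; rewrite linearB /= /transpose_at /= Txy subrr.
Qed.

Lemma positive_range T (K : set E) : positive_map K nonneg_functions T <->
  range (transpose T) `<=` dual_cone K.
Proof.
split=> [Tpos _ [w _ <-] x Kx|Tpos _ [x Kx <-] w].
  by apply: Tpos; exists x.
by apply: (Tpos (transpose T w)) => //; exists w.
Qed.

(** Equicontinuity of the image of K is continuity of T at 0 for uniform
convergence on K; by linearity, continuity at 0 propagates to every point. *)
Lemma Ck_continuous_equicontinuous T :
  continuous (T : E -> C_k R Omega) <->
  forall K : set Omega, compact K -> equicontinuous_set (transpose T @` K).
Proof.
pose ev x : {family compact, Omega -> R} := eval_cont (T x).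
split=> [cT K cK e e0|Teq].
  have : {family compact, ev @ 0 --> ev 0}.
    exact: (@continuous_comp _ _ _ (T : E -> C_k R Omega)
      (eval_cont : C_k R Omega -> {family compact, Omega -> R}) 0 (cT 0)
      (initial_continuous (x := T 0 : C_k R Omega))).
  move=> /fam_cvgP /(_ K cK) /(_ [set h | forall w, K w -> ball (ev 0 w) e (h w)]).
  have near0 : nbhs (ev 0 : {uniform` K -> R})
      [set h | forall w, K w -> ball (ev 0 w) e (h w)].
    apply/uniform_nbhs; exists [set ab | ball ab.1 e ab.2]; split => //.
    exact: entourage_ball (PosNum e0).
  move=> /(_ near0) near_ev; exists [set x | forall w, K w -> ball (ev 0 w) e (ev x w)] => //.
  move=> u _ Uu [w Kw <-]; have := Uu w Kw.
  by rewrite /ball /= /ev linear0 [eval_cont 0 w](_ : _ = 0) // sub0r normrN.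
apply: continuous_comp_initial => x; apply/fam_cvgP => K cK P.
move=> /uniform_nbhs[A [/= entA AP]].
have [e e0 eA] : exists2 e : R, 0 < e & [set ab | ball ab.1 e ab.2] `<=` A.
  by move: entA; rewrite -entourage_ballE => -[e e0 eA]; exists e.
have [U U0 UK] := Teq K cK e e0.
apply: filterS (nbhs_translate x U0) => y Uyx; apply: AP => w Kw; apply: eA.
have := UK _ _ Uyx (ex_intro2 _ _ w Kw erefl).
by rewrite linearB /= distrC.
Qed.

Lemma compact_image_simply_bounded T (K : set Omega) : compact K ->
  simply_bounded (transpose T @` K).
Proof.
move=> cK x; have : compact (eval_cont (T x) @` K).
  apply: continuous_compact cK; apply: continuous_subspaceT.
  exact: (@cts_fun _ _ (T x : continuousType Omega R)).
move=> /compact_bounded [M [_ MK]]; exists (M + 1) => _ [w Kw <-].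
by apply: (MK (M + 1)); [rewrite ltrDl|exists w].
Qed.

(** If T is bipositive, K is an intersection of half-spaces given by the
transpose, so it is weakly closed; and a functional of the dual cone outside
the closed generated cone would be negative at some x with T x >= 0, which is
absurd since such an x lies in K.  Conversely, suppose that K is weakly closed
and its dual cone is the closed generated cone.  If T x >= 0 with x outside K,
separation gives a functional of the dual cone that is negative at x, whereas
every element of the closed generated cone is nonnegative there. *)
Lemma bipositive_duality T (K : set E) : convex_cone K ->
  (bipositive_map K nonneg_functions T <->
   closed (K : set (weak_space E)) /\
   dual_cone K = closure (cone_generated (range (transpose T)))).
Proof.
move=> Kcone; set C := cone_generated _.
have CT w : C (transpose T w) by apply: cone_generated_sub; exists w.
split=> [KT|[Kclosed KC]].
  split.
    move=> x Kx; rewrite KT => w.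
    apply: (closure_ge0 (@coord_initial_continuous _ _ _
      ((fun x phi => dual_fun phi x) : E -> {ptws dual E -> R}) (transpose T w)) _ Kx).
    by move=> y; rewrite KT; exact.
  apply/seteqP; split=> [phi Kphi|].
    apply: contrapT => /(weakstar_cone_separation (cone_generated_convex _)).
    move=> [x [Cx]]; rewrite ltNge => /negP; apply; apply: Kphi.
    by rewrite KT => w; exact: Cx (CT w).
  apply/closure_dual_cone/cone_generated_dual_cone => _ [w _ <-] x.
  by rewrite KT; exact.
apply/seteqP; split=> [x Kx w|x Tx].
  have : dual_cone K (transpose T w) by rewrite KC; exact/subset_closure/CT.
  exact.
apply: contrapT => /(weakly_closed_cone_separation Kcone Kclosed) [phi].
rewrite KC => Cphi; rewrite ltNge => /negP; apply.
have CTx : C `<=` dual_cone [set x].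
  by apply: cone_generated_dual_cone => _ [w _ <-] _ ->; exact: Tx.
exact: (closure_dual_cone CTx Cphi).
Qed.

End Transpose.

Theorem lemmaA (R : realType) (E : topologicalLmodType R)
    (Omega : topologicalType) (hE : hausdorff_space E) :
  exists transpose : representation E Omega -> continuousType Omega (dual E),
    (* (a) *)
    [/\ bijective transpose,
        (forall (T : representation E Omega) (x : E) (w : Omega),
           eval_cont (T x) w = transpose T w x) &
     forall T : representation E Omega,
      [/\ (* (b) *)
          injective T <-> separates_points (range (transpose T)),
          (* (c) *)
          continuous (T : E -> C_k R Omega) <->
            (forall K : set Omega, compact K ->
               equicontinuous_set (transpose T @` K)),
          barrelled_space E -> continuous (T : E -> C_k R Omega),
          frechet_space E -> continuous (T : E -> C_k R Omega) &
       forall Epos : set E, convex_cone Epos ->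
          (* (d) *)
          (positive_map Epos nonneg_functions T <->
             range (transpose T) `<=` dual_cone Epos) /\
          (* (e) *)
          (bipositive_map Epos nonneg_functions T <->
             closed (Epos : set (weak_space E)) /\
             dual_cone Epos = closure (cone_generated (range (transpose T))))]].
Proof.
exists transpose; split=> [||T]; [exact: transpose_bijective|by []|split].
- exact: injective_separates.
- exact: Ck_continuous_equicontinuous.
- move=> [_ Ebarrelled]; apply/Ck_continuous_equicontinuous => K cK.
  exact/Ebarrelled/simply_bounded_tvs_bounded/compact_image_simply_bounded.
- move=> [_ Emetrizable Ecomplete]; apply/Ck_continuous_equicontinuous => K cK.
  apply: complete_metrizable_banach_steinhaus => //.
  exact: compact_image_simply_bounded.
- move=> Epos Econe; split; first exact: positive_range.
  exact: bipositive_duality.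
Qed.
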